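(* Let $N\ge 2$ be an integer and let $q$ be a primitive $N$th root of unity. Let $\mathscr{A}[\tau]$ be a semi-commutative Galois extension of $\mathscr{A}$ by means of $\tau$, equipped with its $\mathbb{Z}_N$-graded structure $\mathscr{A}[\tau]=\bigoplus_{k=0}^{N-1}\mathscr{A}^k[\tau]$ (elements of $\mathscr{A}$ have degree $0$, $\tau$ has degree $1$), and with the inner graded $q$-derivation $d=[\tau,\,\cdot\,]_q$ induced by $\tau$. Then $\mathscr{A}[\tau]$ is a graded $q$-differential algebra and $d$ is its $N$-differential (in particular $d^N=0$). Moreover, for any element $\xi\in\mathscr{A}[\tau]$ written as a sum of elements of the right $\mathscr{A}$-modules $\mathscr{A}^k[\tau]$, $$\xi=\sum_{k=0}^{N-1}\tau^k u_k,\qquad u_k\in\mathscr{A},$$ it holds $$d\xi=\sum_{k=0}^{N-1}\tau^{k+1}\bigl(u_k-q^k\,(u_k)_\tau\bigr),$$ where $u\mapsto u_\tau$ is the endomorphism of $\mathscr{A}$ induced by the bimodule structure of $\mathscr{A}^1[\tau]$, i.e. determined by $u\,\tau=\tau\,u_\tau$.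
   Context: Noncommutative Galois extension: let $\tilde{\mathscr{A}}$ be an associative unital $\mathbb{C}$-algebra with identity $\mathbb{1}$, $\mathscr{A}\subset\tilde{\mathscr{A}}$ a (unital) subalgebra, and $\tau\in\tilde{\mathscr{A}}$ an element such that $\tau^N=\pm\mathbb{1}$ and $\tau^k\notin\mathscr{A}$ for every integer $1\le k\le N-1$. The smallest subalgebra $\mathscr{A}[\tau]\subset\tilde{\mathscr{A}}$ containing $\mathscr{A}$ and $\tau$ is the noncommutative Galois extension of $\mathscr{A}$ by means of $\tau$. It is called semi-commutative if the left $\mathscr{A}$-module $\mathscr{A}\tau$ and the right $\mathscr{A}$-module $\tau\mathscr{A}$ generated by $\tau$ coincide; this common $\mathscr{A}$-bimodule is denoted $\mathscr{A}^1[\tau]$. Then every $u\in\mathscr{A}$ satisfies $u\,\tau=\tau\,u_\tau$ for a unique $u_\tau\in\mathscr{A}$, and $u\mapsto u_\tau$ is an algebra endomorphism of $\mathscr{A}$. Grading: $\mathscr{A}^0[\tau]=\mathscr{A}$ and $\mathscr{A}^k[\tau]=\tau^k\mathscr{A}=\mathscr{A}\tau^k$ for $1\le k\le N-1$. The sum $\mathscr{A}[\tau]=\bigoplus_{k=0}^{N-1}\mathscr{A}^k[\tau]$ is taken to be direct, which makes $\mathscr{A}[\tau]$ a $\mathbb{Z}_N$-graded algebra with $\mathscr{A}^k[\tau]$ the subspace of degree $k$. For homogeneous elements $u,v$ of a $\mathbb{Z}_N$-graded algebra of degrees $|u|,|v|$, the graded $q$-commutator is $[v,u]_q=v\,u-q^{|v||u|}u\,v$.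 A graded $q$-derivation of degree one is a linear map $d$ of degree one satisfying $d(uv)=d(u)\,v+q^{|u|}u\,d(v)$ for $u$ homogeneous; the inner graded $q$-derivation of degree one induced by an element $v$ of degree one is $d(u)=[v,u]_q=v\,u-q^{|u|}u\,v$ (extended linearly from homogeneous $u$). A graded $q$-differential algebra is a graded associative unital algebra endowed with a graded $q$-derivation $d$ of degree one (called the $N$-differential) such that $d^N=0$. *)

(* Defs.v *)
From HB Require Import structures.
From mathcomp Require Import all_boot all_order all_algebra.
From mathcomp Require Import boolp classical_sets reals.
From mathcomp.real_closed Require Export complex.

Set Implicit Arguments.
Unset Strict Implicit.
Unset Printing Implicit Defensive.

Import GRing.Theory.

Local Open Scope classical_set_scope.
Local Open Scope ring_scope.

(** * Z_N-graded algebras and graded q-differential calculus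

    The degrees live in ['Z_N], which is the ring of integers modulo [N] only
    for [1 < N].  Powers [q ^+ k] with [k : 'Z_N] use the representative of [k]
    in [0, N); for [q ^+ N = 1] the choice of representative is irrelevant. *)

Section GradedAlgebra.
Variables (C : fieldType) (B : algType C) (N : nat) (Bk : 'Z_N -> set B).

(* [c] is a family of homogeneous elements, one in each degree, with sum [x]. *)
Definition decomposition (x : B) (c : {ffun 'Z_N -> B}) : Prop :=
  (forall k, Bk k (c k)) /\ x = \sum_k c k.

Definition direct_sum : Prop :=
  forall c : {ffun 'Z_N -> B}, decomposition 0 c -> forall k, c k = 0.

Definition graded_algebra : Prop :=
  [/\ forall k, submod_closed (mem (Bk k)),
      direct_sum,
      forall x, exists c, decomposition x c,
      Bk 0 1
    & forall i j u v, Bk i u -> Bk j v -> Bk (i + j) (u * v)].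

(* When [Bk] is a grading the decomposition of [x] is unique. *)
Definition component (x : B) : {ffun 'Z_N -> B} :=
  xget [ffun=> 0] [set c | decomposition x c].

(* [v, u]_q for homogeneous [v], [u] of respective degrees [i], [j]. *)
Definition q_commutator (q : C) (i j : nat) (v u : B) : B :=
  v * u - q ^+ (i * j) *: (u * v).

(* [v, .]_q for [v] of degree one, extended linearly from the homogeneous
   elements. *)
Definition inner_q_derivation (q : C) (v x : B) : B :=
  \sum_(k : 'Z_N) q_commutator q 1 k v (component x k).

Definition graded_q_derivation (q : C) (d : B -> B) : Prop :=
  [/\ linear d,
      forall k u, Bk k u -> Bk (k + 1) (d u)
    & forall k u v, Bk k u -> d (u * v) = d u * v + q ^+ k *: (u * d v)].

Definition graded_q_differential_algebra (q : C) (d : B -> B) : Prop :=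
  [/\ graded_algebra,
      graded_q_derivation q d
    & forall x, iter N d x = 0].

End GradedAlgebra.

(** * Noncommutative Galois extensions *)

Section GaloisExtension.
Variables (C : fieldType) (At : algType C) (A : set At) (tau : At).

Definition galois_generator (N : nat) : Prop :=
  (tau ^+ N = 1 \/ tau ^+ N = -1) /\
  (forall k, (0 < k < N)%N -> ~ A (tau ^+ k)).

Definition galois_ext_pred : {pred At} :=
  mem (smallest [set S : set At | subalg_closed (mem S)] (A `|` [set tau])).

Fact galois_ext_subalg : subalg_closed galois_ext_pred.
Proof.
split; first by rewrite inE => S [[S1 _ _] _]; rewrite -inE.
- move=> a u v; rewrite !inE => hu hv S hS; rewrite -inE.
  by case: (hS) => -[_ Slin _] _; apply: Slin; rewrite inE; [exact: hu|exact: hv].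
- move=> u v; rewrite !inE => hu hv S hS; rewrite -inE.
  by case: (hS) => -[_ _ SM] _; apply: SM; rewrite inE; [exact: hu|exact: hv].
Qed.

HB.instance Definition _ :=
  GRing.isSubalgClosed.Build C At galois_ext_pred
    (GRing.subalg_closed_semi galois_ext_subalg).

(* The algebra A[tau]; [val] is its inclusion in the ambient algebra. *)
Definition galois_ext : Type := {x : At | x \in galois_ext_pred}.

HB.instance Definition _ := SubChoice.on galois_ext.
HB.instance Definition _ := [SubChoice_isSubAlgebra of galois_ext by <:].

Fact galois_ext_tau : tau \in galois_ext_pred.
Proof. by rewrite inE => S [_]; apply; right. Qed.

Definition galois_tau : galois_ext := exist _ tau galois_ext_tau.

(* The left module [A tau] and the right module [tau A] coincide. *)
Definition semi_commutative : Prop :=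
  [set u * tau | u in A] = [set tau * u | u in A].

Definition galois_grade (N : nat) (k : 'Z_N) : set galois_ext :=
  [set x | exists2 u, A u & val x = tau ^+ k * u].

(* The element [w = u_tau] of [A] with [u tau = tau w], which is unique when
   [tau] is invertible. *)
Definition twist (u : At) : At :=
  xget 0 [set w | A w /\ u * tau = tau * w].

End GaloisExtension.

(* Main.v *)
Require Import Defs.
From mathcomp Require Import all_boot all_order all_algebra.
From mathcomp Require Import boolp classical_sets reals.
From mathcomp.real_closed Require Import complex.

(** Write L and R for left and right multiplication by [v], where [v] has degree
    one.  On homogeneous elements of degree [k] the derivation [[v, .]_q] is
    L - q^k R, and it raises the degree by one, so its [N]-th iterate on degree
    [k] is the product of the operators L - q^(k+j) R for [j < N].  As L and R
    commute and the q^(k+j) run through all [N]-th roots of unity, this product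
    is L^N - R^N, that is, the commutator with [v ^+ N]
    ([iterated_q_commutator]).  Hence in any Z_N-graded algebra the inner graded
    q-derivation by [v] has vanishing [N]-th power as soon as [v ^+ N] is central
    ([inner_q_differential]); the q-Leibniz rule is a telescoping identity.

    For A[tau] the power [tau ^+ N] is [1] or [-1], hence central, and it
    remains to see that the modules tau^k A form a grading ([galois_grading]).
    Semi-commutativity moves elements of [A] to the right across powers of
    [tau], and exponents can be reduced modulo [N] at the price of a sign absorbed
    in [A]; this gives closure under products.  It also shows that the sums of
    homogeneous elements form a subalgebra containing [A] and [tau], hence are
    all of A[tau].  The formula for the derivation is then the degreewise
    expression tau (tau^k u) - q^k (tau^k u) tau, rewritten with
    u tau = tau u_tau. *)

Set Implicit Arguments.
Unset Strict Implicit.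
Unset Printing Implicit Defensive.

Import GRing.Theory.

Local Open Scope ring_scope.

(** * Iterated q-commutators *)

Lemma val_ZpD N (i j : 'Z_N) :
  (1 < N)%N -> (i + j)%R = ((i + j) %% N)%N :> nat.
Proof. by move=> N_gt1; congr (_ %% _)%N; apply: Zp_cast. Qed.

Section IteratedCommutator.
Variables (C : fieldType) (B : algType C).

(** The operators L - c_j R, with L and R the left and right multiplications by
    [v], commute, so that their product is the homogenization in (L, R) of the
    polynomial with roots c_j. *)
Lemma iterated_commutator (v x : B) (c : nat -> C) (F : nat -> B) :
    F 0%N = x -> (forall n, F n.+1 = v * F n - c n *: (F n * v)) ->
  forall n, F n = \sum_(i < n.+1)
    (\prod_(j < n) ('X - (c j)%:P))`_i *: (v ^+ i * x * v ^+ (n - i)).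
Proof.
move=> F0 FS; elim=> [|n IHn].
  by rewrite big_ord1 big_ord0 coef1 scale1r mul1r mulr1.
rewrite FS; under eq_bigr do rewrite big_ord_recr /=.
set p := \prod_(j < n) _ in IHn *.
have szp : (size p <= n.+1)%N.
  rewrite /p -(big_mkord xpredT (fun j => 'X - (c j)%:P)).
  by rewrite size_prod_XsubC size_iota subn0.
(* Both sums are extended by a vanishing term to the range [i < n.+2]. *)
have -> : v * F n =
    \sum_(i < n.+2) (p * 'X)`_i *: (v ^+ i * x * v ^+ (n.+1 - i)).
  rewrite big_ord_recl coefMX scale0r add0r IHn mulr_sumr.
  apply: eq_bigr => i _; rewrite coefMX /= -scalerAr !mulrA -exprS.
  by rewrite /bump /= add1n subSS.
have -> : F n * v =
    \sum_(i < n.+2) p`_i *: (v ^+ i * x * v ^+ (n.+1 - i)).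
  rewrite big_ord_recr /= nth_default // scale0r addr0 IHn mulr_suml.
  apply: eq_bigr => i _; rewrite -scalerAl -!mulrA -exprSr subSn //.
  by rewrite -ltnS.
rewrite scaler_sumr -sumrB; apply: eq_bigr => i _.
by rewrite mulrBr coefB coefMC scalerBl scalerA [c n * _]mulrC.
Qed.

(** A shift of the exponents only permutes the powers of a primitive root. *)
Lemma prod_XsubC_prim_shift (n : nat) (q : C) (k : nat) :
    (0 < n)%N -> n.-primitive_root q ->
  \prod_(j < n) ('X - (q ^+ (k + j))%:P) = 'X^n - 1.
Proof.
case: n => // n _ q_prim; rewrite -(factor_Xn_sub_1 q_prim) big_mkord.
pose s (j : 'I_n.+1) : 'I_n.+1 := inord ((k + j) %% n.+1).
have sE j : s j = ((k + j) %% n.+1)%N :> nat by rewrite inordK // ltn_mod.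
have s_inj : injective s.
  move=> i j /(congr1 val); rewrite /= !sE => /eqP.
  by rewrite eqn_modDl !modn_small // => /eqP/val_inj.
rewrite [RHS](reindex_inj s_inj) /=; apply: eq_bigr => j _.
by rewrite sE (prim_expr_mod q_prim).
Qed.

(** With c_j = q^(k+j) the polynomial is X^n - 1, whose homogenization is
    L^n - R^n: only the two extreme terms survive. *)
Lemma iterated_q_commutator (n : nat) (q : C) (k : nat) (v x : B) (F : nat -> B) :
    (0 < n)%N -> n.-primitive_root q -> F 0%N = x ->
    (forall i, F i.+1 = v * F i - q ^+ (k + i) *: (F i * v)) ->
  F n = v ^+ n * x - x * v ^+ n.
Proof.
move=> n_gt0 q_prim F0 FS.
rewrite (iterated_commutator F0 FS) prod_XsubC_prim_shift //.
case: n n_gt0 {q_prim} => // n _; rewrite big_ord_recl big_ord_recr /=.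
rewrite big1 => [|i _].
  rewrite !coefB !coefXn !coef1 /bump /= !add1n eqxx subnn subn0 !expr0.
  by rewrite sub0r add0r subr0 scaleN1r scale1r mul1r mulr1 addrC.
rewrite coefB coefXn coef1 /bump /= add1n eqSS.
by rewrite (ltn_eqF (ltn_ord i)) subrr scale0r.
Qed.

End IteratedCommutator.

(** * Decompositions into homogeneous elements *)

Section Decomposition.
Variables (C : fieldType) (B : algType C) (N : nat) (Bk : 'Z_N -> set B).
Hypothesis Bk_submod : forall k, GRing.submod_closed (mem (Bk k)).

Lemma grade0 k : Bk k 0.
Proof. by case: (Bk_submod k); rewrite inE. Qed.

Lemma gradeZD k a u v : Bk k u -> Bk k v -> Bk k (a *: u + v).
Proof.
case: (Bk_submod k) => _ lin Bu Bv.
by have := lin a u v; rewrite !inE; apply.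
Qed.

Lemma decompositionZD a x y c c' :
    decomposition Bk x c -> decomposition Bk y c' ->
  decomposition Bk (a *: x + y) [ffun k => a *: c k + c' k].
Proof.
move=> [Bc ->] [Bc' ->]; split=> [k|]; first by rewrite ffunE; apply: gradeZD.
by rewrite scaler_sumr -big_split; apply: eq_bigr => k _; rewrite ffunE.
Qed.

Lemma homogeneous_decomposition k u :
  Bk k u -> decomposition Bk u [ffun j => if j == k then u else 0].
Proof.
move=> Bu; split=> [j|].
  by rewrite ffunE; case: eqP => [->|_] //; apply: grade0.
rewrite (bigD1 k) //= ffunE eqxx big1 ?addr0 // => j /negPf jk.
by rewrite ffunE jk.
Qed.

(** The summands need not be homogeneous: this is what allows spanning to be
    checked on products of decomposable elements. *)
Lemma decomposable_sum (I : finType) (x : I -> B) :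
    (forall i, exists c, decomposition Bk (x i) c) ->
  exists c, decomposition Bk (\sum_i x i) c.
Proof.
move=> dec; apply: (big_ind (fun y => exists c, decomposition Bk y c));
  [|move=> y z [c yc] [c' zc']|by move=> i _; exact: dec].
  exact: ex_intro _ _ (homogeneous_decomposition (grade0 0)).
by rewrite -[y]scale1r; exact: ex_intro _ _ (decompositionZD 1 yc zc').
Qed.

Lemma decomposition_unique x c c' : direct_sum Bk ->
  decomposition Bk x c -> decomposition Bk x c' -> c = c'.
Proof.
move=> dir xc /(decompositionZD (-1))/(_ xc).
rewrite scaleN1r addNr => /dir eq_c; apply/ffunP => k.
by have := eq_c k; rewrite ffunE scaleN1r addrC => /subr0_eq.
Qed.

End Decomposition.

(** * Inner graded q-derivations *)

Section InnerDerivation.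
Variables (C : fieldType) (B : algType C) (N : nat) (Bk : 'Z_N -> set B).
Hypothesis grading : graded_algebra Bk.

Let Bk_submod : forall k, GRing.submod_closed (mem (Bk k)).
Proof. by case: grading. Qed.

Lemma gradeM i j u v : Bk i u -> Bk j v -> Bk (i + j) (u * v).
Proof. by case: grading => _ _ _ _; apply. Qed.

Lemma componentP x : decomposition Bk x (component Bk x).
Proof.
apply: (@xgetPex _ [ffun=> 0] [set c | decomposition Bk x c]%classic).
by case: grading => _ _ /(_ x).
Qed.

Lemma componentE x c : decomposition Bk x c -> component Bk x = c.
Proof.
by case: grading => _ dir _ _ _; apply: decomposition_unique (componentP x).
Qed.

Lemma component_linear k : linear (fun x => component Bk x k).
Proof.
move=> a x y; have := decompositionZD Bk_submod a (componentP x) (componentP y).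
by move/componentE => ->; rewrite ffunE.
Qed.

Variables (q : C) (v : B).
Local Notation d := (inner_q_derivation Bk q v).

Lemma inner_q_derivationE x c : decomposition Bk x c ->
  d x = \sum_k (v * c k - q ^+ k *: (c k * v)).
Proof.
move=> /componentE xc; rewrite /inner_q_derivation xc.
by apply: eq_bigr => k _; rewrite /q_commutator mul1n.
Qed.

Lemma inner_q_derivation_homogeneous k u :
  Bk k u -> d u = v * u - q ^+ k *: (u * v).
Proof.
move/(homogeneous_decomposition Bk_submod)/inner_q_derivationE ->.
rewrite (bigD1 k) //= ffunE eqxx big1 ?addr0 // => j /negPf jk.
by rewrite ffunE jk mulr0 mul0r scaler0 subrr.
Qed.

Lemma inner_q_derivation_linear : linear d.
Proof.
move=> a x y; rewrite scaler_sumr -big_split; apply: eq_bigr => k _ /=.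
rewrite /q_commutator component_linear.
rewrite mulrDr mulrDl -scalerAr -scalerAl !scalerDr scalerN.
by rewrite opprD addrACA !scalerA [a * _]mulrC.
Qed.

Lemma inner_q_derivation_sum (I : finType) (c : I -> B) :
  d (\sum_i c i) = \sum_i d (c i).
Proof.
have dD : {morph d : x y / x + y}.
  by move=> x y; rewrite -[x]scale1r inner_q_derivation_linear !scale1r.
apply: (big_morph d dD).
by apply: (@addrI _ (d 0)); rewrite -dD !addr0.
Qed.

Hypotheses (N_gt1 : (1 < N)%N) (q_prim : N.-primitive_root q).
Hypothesis v_deg1 : Bk 1 v.

(** The representative of a sum in ['Z_N] may differ by [N] from the sum of the
    representatives; powers of [q] do not see the difference. *)
Lemma expr_ZpD (i j : 'Z_N) : q ^+ (i + j)%R = q ^+ (i + j)%N.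
Proof. by rewrite val_ZpD // (prim_expr_mod q_prim). Qed.

Lemma inner_q_derivation_degree k u : Bk k u -> Bk (k + 1) (d u).
Proof.
move=> Bu; rewrite (inner_q_derivation_homogeneous Bu) [_ - _]addrC -scaleNr.
by apply: (gradeZD Bk_submod); [exact: gradeM|rewrite addrC; exact: gradeM].
Qed.

(** By linearity one may take [w] homogeneous, of degree [j]; the terms
    q^k u v w then cancel, leaving v u w - q^(k+j) u w v. *)
Lemma inner_q_derivation_leibniz k u w :
  Bk k u -> d (u * w) = d u * w + q ^+ k *: (u * d w).
Proof.
move=> Bu; have [Bw {1 2}->] := componentP w.
rewrite mulr_sumr inner_q_derivation_sum mulr_sumr.
rewrite (inner_q_derivationE (componentP w)).
rewrite mulr_sumr scaler_sumr -big_split; apply: eq_bigr => j _ /=.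
rewrite (inner_q_derivation_homogeneous (gradeM Bu (Bw j))).
rewrite (inner_q_derivation_homogeneous Bu) expr_ZpD exprD.
rewrite mulrBl mulrBr scalerBr -!scalerAl -!scalerAr scalerA !mulrA.
by rewrite addrA subrK.
Qed.

(** The [i]-th iterate is homogeneous of degree [k + i], so each further step is
    the commutator twisted by q^(k+i). *)
Lemma iter_inner_q_derivation k u :
  Bk k u -> iter N d u = v ^+ N * u - u * v ^+ N.
Proof.
move=> Bu; have N_gt0 := ltnW N_gt1.
have Biter i : Bk (k + i%:R) (iter i d u).
  elim: i => [|i IHi]; first by rewrite addr0.
  by rewrite -natr1 addrA; apply: inner_q_derivation_degree.
apply: (@iterated_q_commutator _ _ N q k v u (fun i => iter i d u)) => // i.
rewrite iterS (inner_q_derivation_homogeneous (Biter i)) expr_ZpD.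
by rewrite !exprD val_Zp_nat // (prim_expr_mod q_prim).
Qed.

(** On every homogeneous component the [N]-th iterate is the ordinary commutator
    with [v ^+ N], which vanishes when [v ^+ N] is central. *)
Theorem inner_q_differential : (forall u, v ^+ N * u = u * v ^+ N) ->
  graded_q_differential_algebra Bk q d.
Proof.
move=> vN_central; split=> //.
  split; first exact: inner_q_derivation_linear.
    exact: inner_q_derivation_degree.
  exact: inner_q_derivation_leibniz.
have iter_sum m (c : 'Z_N -> B) :
    iter m d (\sum_k c k) = \sum_k iter m d (c k).
  by elim: m => //= m ->; rewrite inner_q_derivation_sum.
move=> x; have [Bx ->] := componentP x.
rewrite iter_sum big1 // => k _.
by rewrite (iter_inner_q_derivation (Bx k)) vN_central subrr.
Qed.

End InnerDerivation.

(** * The grading of a semi-commutative Galois extension *)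

Section GaloisGrading.
Variables (C : fieldType) (At : algType C) (A : set At) (tau : At) (N : nat).
Hypotheses (N_gt1 : (1 < N)%N) (A_subalg : GRing.subalg_closed (mem A)).
Hypothesis tauN : tau ^+ N = 1 \/ tau ^+ N = -1.
Hypothesis A_semicomm : semi_commutative A tau.

Local Notation grade := (@galois_grade _ At A tau N).

Lemma base1 : A 1.
Proof. by case: A_subalg; rewrite inE. Qed.

Lemma baseZD a u w : A u -> A w -> A (a *: u + w).
Proof.
case: A_subalg => _ lin _ Au Aw.
by have := lin a u w; rewrite !inE; apply.
Qed.

Lemma baseM u w : A u -> A w -> A (u * w).
Proof.
case: A_subalg => _ _ mul Au Aw.
by have := mul u w; rewrite !inE; apply.
Qed.

Lemma base0 : A 0.
Proof. by rewrite -(addNr 1) -scaleN1r; apply: baseZD; apply: base1. Qed.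

(** Existence comes from the inclusion of A tau in tau A. *)
Lemma twistP u : A u -> A (twist A tau u) /\ u * tau = tau * twist A tau u.
Proof.
move=> Au; have : [set tau * w | w in A]%classic (u * tau).
  by rewrite -A_semicomm; exists u.
case=> w Aw wE.
apply: (@xgetPex _ 0 [set w | A w /\ u * tau = tau * w]%classic).
by exists w.
Qed.

Lemma base_exp_tau k u : A u -> exists2 w, A w & u * tau ^+ k = tau ^+ k * w.
Proof.
move=> Au; elim: k => [|k [w Aw wE]]; first by exists u; rewrite ?mulr1 ?mul1r.
have [Aw' w'E] := twistP Aw; exists (twist A tau w) => //.
by rewrite exprSr mulrA wE -!mulrA w'E.
Qed.

Lemma exp_tau_mod m : exists a : C, tau ^+ m = a *: tau ^+ (m %% N).
Proof.
have [e tauE] : exists e : C, tau ^+ N = e%:A.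
  by case: tauN => ->; [exists 1|exists (-1)]; rewrite ?scale1r ?scaleN1r.
exists (e ^+ (m %/ N)).
rewrite {1}(divn_eq m N) exprD mulnC exprM tauE exprZn expr1n.
by rewrite -scalerAl mul1r.
Qed.

(** The scalar relating tau^m to tau^(m mod N) is absorbed in [A], so any
    exponent congruent to the degree may be used. *)
Lemma galois_gradeP (k : 'Z_N) (m : nat) (x : galois_ext A tau) u :
  k = (m %% N)%N :> nat -> A u -> val x = tau ^+ m * u -> grade k x.
Proof.
move=> km Au xE; have [a aE] := exp_tau_mod m.
exists (a *: u); last by rewrite xE aE km -scalerAl -scalerAr.
by rewrite -[_ *: _]addr0; apply: baseZD => //; exact: base0.
Qed.

(** tau^i u tau^j w = tau^(i+j) u' w, where u' is the element of [A] obtained by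
    carrying [u] across tau^j. *)
Lemma galois_gradeM (i j : 'Z_N) (x y : galois_ext A tau) :
  grade i x -> grade j y -> grade (i + j) (x * y).
Proof.
move=> [u Au xE] [w Aw yE]; have [u' Au' u'E] := base_exp_tau j Au.
apply: (@galois_gradeP _ (i + j) _ (u' * w)); last 1 first.
- by rewrite rmorphM /= xE yE -mulrA (mulrA u) u'E exprD !mulrA.
- exact: val_ZpD.
- exact: baseM.
Qed.

Lemma galois_grade_submod k : GRing.submod_closed (mem (grade k)).
Proof.
split; first by rewrite inE; exists 0; rewrite ?mulr0 ?rmorph0 //; exact: base0.
move=> a x y; rewrite !inE => -[u Au xE] [w Aw yE].
exists (a *: u + w); first exact: baseZD.
by rewrite linearP /= xE yE mulrDr -scalerAr.
Qed.

Lemma galois_ext_base u : A u -> u \in galois_ext_pred A tau.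
Proof. by move=> Au; rewrite inE => S [_]; apply; left. Qed.

Definition galois_base u (Au : A u) : galois_ext A tau :=
  exist _ u (galois_ext_base Au).

(** The decomposable elements form a subalgebra containing [A] and [tau]. By
    minimality of A[tau] there are no others. *)
Lemma galois_ext_decomposable (x : galois_ext A tau) :
  exists c, decomposition grade x c.
Proof.
pose dec y := exists c, decomposition grade y c.
have decH k y : grade k y -> dec y.
  move/(homogeneous_decomposition galois_grade_submod) => dec_y.
  by eexists; exact: dec_y.
have decM y z : dec y -> dec z -> dec (y * z).
  move=> [c [Bc ->]] [c' [Bc' ->]]; rewrite mulr_suml.
  apply: (decomposable_sum galois_grade_submod) => i; rewrite mulr_sumr.
  apply: (decomposable_sum galois_grade_submod) => j.
  by apply: decH; apply: galois_gradeM (Bc i) (Bc' j).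
have dec_base u (Au : A u) : dec (galois_base Au).
  apply: (decH 0); apply: (@galois_gradeP _ 0 _ u) => //.
    by rewrite mod0n.
  by rewrite mul1r.
have dec_tau : dec (galois_tau A tau).
  apply: (decH 1); apply: (@galois_gradeP _ 1 _ 1).
  - by rewrite modn_small.
  - exact: base1.
  - by rewrite mulr1.
pose S : set At := [set val y | y in dec]%classic.
have S_subalg : GRing.subalg_closed (mem S).
  split.
  - by rewrite inE; exists (galois_base base1).
  - move=> a u w; rewrite !inE => -[y [c yc] <-] [z [c' zc'] <-].
    exists (a *: y + z); last by rewrite linearP.
    by eexists; apply: (decompositionZD galois_grade_submod a yc zc').
  - move=> u w; rewrite !inE => -[y yc <-] [z zc <-].
    by exists (y * z); [exact: decM|rewrite rmorphM].
have : S (val x).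
  have := valP x; rewrite inE; apply; split=> // y [Ay|->].
    by exists (galois_base Ay).
  by exists (galois_tau A tau).
by case=> y decy /val_inj <-.
Qed.

Lemma galois_grading : direct_sum grade -> graded_algebra grade.
Proof.
split=> //.
- exact: galois_grade_submod.
- exact: galois_ext_decomposable.
- by exists 1; [exact: base1|rewrite mul1r].
- exact: galois_gradeM.
Qed.

End GaloisGrading.

Theorem proposition2 (R : realType) (At : algType R[i]) (A : set At) (tau : At)
    (N : nat) (q : R[i])
    (N_ge2 : (2 <= N)%N)
    (q_prim : N.-primitive_root q)
    (A_subalg : GRing.subalg_closed (mem A))
    (tau_gen : galois_generator A tau N)
    (A_semicomm : semi_commutative A tau)
    (A_direct : direct_sum (@galois_grade _ At A tau N)) :
  let grade := @galois_grade _ At A tau N in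
  let d := inner_q_derivation grade q (galois_tau A tau) in
  graded_q_differential_algebra grade q d /\
  (forall (xi : galois_ext A tau) (u : 'I_N -> At),
     (forall k, A (u k)) ->
     val xi = \sum_(k < N) tau ^+ k * u k ->
     val (d xi) =
       \sum_(k < N) tau ^+ k.+1 * (u k - q ^+ k *: twist A tau (u k))).
Proof.
move=> grade d; have [tauN _] := tau_gen.
have grading := galois_grading N_ge2 A_subalg tauN A_semicomm A_direct.
split.
  apply: inner_q_differential => //.
    apply: (galois_gradeP A_subalg tauN (m := 1) (u := 1)).
    - by rewrite modn_small.
    - exact: base1 A_subalg.
    - by rewrite mulr1.
  move=> x; apply: val_inj; rewrite !rmorphM !rmorphXn /=.
  by case: tauN => ->; rewrite ?mulN1r ?mulrN1 ?mul1r ?mulr1.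
(* For [N] of the form [n.+2] the types ['Z_N] and ['I_N] are convertible. *)
rewrite {}/d {}/grade in grading *.
case: N N_ge2 {q_prim tau_gen A_direct tauN} grading => [|[|n]] // _ grading.
move=> xi u Au xiE.
have xi_dec : decomposition (@galois_grade _ At A tau n.+2) xi
    [ffun k : 'Z_n.+2 => galois_tau A tau ^+ k * galois_base tau (Au k)].
  split=> [k|]; first by rewrite ffunE; exists (u k); rewrite ?rmorphM ?rmorphXn.
  apply: val_inj; rewrite xiE rmorph_sum; apply: eq_bigr => k _.
  by rewrite ffunE rmorphM rmorphXn.
rewrite (inner_q_derivationE grading _ _ xi_dec) rmorph_sum.
apply: eq_bigr => k _; rewrite ffunE rmorphB linearZ !rmorphM rmorphXn /=.
have [_ twE] := twistP A_semicomm (Au k).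
by rewrite -mulrA twE mulrBr scalerN -scalerAr !mulrA -exprS -exprSr.
Qed.
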